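(* Fix a positive integer $n$. Let $\mathcal{P}_n \times \mathcal{P}_n$ be given the uniform probability measure defined by Lebesgue measure from the embedding into $\mathbb{R}^{2n}$ (that is, the product of two copies of the uniform probability measure on $\mathcal{P}_n$). Then the expected value of $\mathbb{EMD}$ on $\mathcal{P}_n \times \mathcal{P}_n$ is $\mathcal{M}_n$, where $\mathcal{M}_n = \mathcal{M}_{n,n}$ and $\mathcal{M}_{p,q}$ is defined on ordered pairs of non-negative integers $(p,q)$ by $\mathcal{M}_{p,q} = 0$ if either $p$ or $q$ is not positive, and $$\mathcal{M}_{p,q} = \frac{(p-1)\mathcal{M}_{p-1,q} + (q-1)\mathcal{M}_{p,q-1} + |p-q|}{p+q-1}$$ for positive integers $p,q$.
   Context: For a positive integer $n$, let $[n]=\{1,\dots,n\}$, and let $\mathcal{P}_n = \{ f \in \mathbb{R}^n : f_i \ge 0 \text{ for all } i,\ f_1+\cdots+f_n = 1\}$ be the set of all probability measures on $[n]$ (the probability simplex). It is a compact polyhedron in a hyperplane of $\mathbb{R}^n$ and inherits $(n-1)$-dimensional Lebesgue measure from that hyperplane; normalizing this measure so that $\mathcal{P}_n$ has total mass one gives the uniform probability measure on $\mathcal{P}_n$. The set $\mathcal{P}_n\times\mathcal{P}_n$ carries the product probability measure. For $\mu,\nu\in\mathcal{P}_n$, let $\mathcal{J}_{\mu\nu}$ be the set of $n\times n$ matrices $J$ with non-negative real entries such that $\sum_{i=1}^n J_{ij} = \mu_j$ for all $j$ and $\sum_{j=1}^n J_{ij} = \nu_i$ for all $i$. The Earth Mover's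 Distance is $$\mathbb{EMD}(\mu,\nu) = \inf_{J\in\mathcal{J}_{\mu\nu}} \sum_{i,j=1}^n |i-j|\,J_{ij}.$$ *)

(* Defs.v *)
From HB Require Import structures.
From mathcomp Require Import all_boot all_order all_algebra.
From mathcomp Require Import all_classical all_reals all_analysis.
From mathcomp Require Import measurable_realfun.

Set Implicit Arguments.
Unset Strict Implicit.
Unset Printing Implicit Defensive.

Import Order.TTheory GRing.Theory Num.Theory.
Import numFieldNormedType.Exports.

Local Open Scope classical_set_scope.
Local Open Scope ring_scope.

Lemma sigma_finite_prod d1 d2 (T1 : measurableType d1) (T2 : measurableType d2)
    (R : realType) (m1 : {sigma_finite_measure set T1 -> \bar R})
    (m2 : {sigma_finite_measure set T2 -> \bar R}) :
  sigma_finite setT (m1 \x m2)%E.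
Proof.
have /sigma_finiteP[F [FT ndF Foo]] := sigma_finiteT m1.
have /sigma_finiteP[G [GT ndG Goo]] := sigma_finiteT m2.
exists (fun k => F k `*` G k).
  rewrite -setXTT FT GT; apply/seteqP; split => -[x y] /=.
    move=> [[i _ Fix] [j _ Gjy]]; exists (maxn i j) => //; split.
      by move: x Fix; exact/subsetPset/ndF/leq_maxl.
    by move: y Gjy; exact/subsetPset/ndG/leq_maxr.
  by move=> [k _ []/= ? ?]; split; exists k.
move=> k; have [? ?] := Foo k; have [? ?] := Goo k.
split; first exact: measurableX.
by rewrite product_measure1E// lte_mul_pinfty// ge0_fin_numE.
Qed.

Section image_measure.
Context d1 d2 (T1 : measurableType d1) (T2 : measurableType d2) (R : realType).
Context (m : {measure set T1 -> \bar R}) (f : T1 -> T2).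

(* The measurability proof is an argument so that the measure structure of the
   pushforward can be inferred. *)
Definition image_measure of measurable_fun setT f : set T2 -> \bar R :=
  pushforward m f.

Context (mf : measurable_fun setT f).

Let image_measure0 : image_measure mf set0 = 0%E.
Proof. by rewrite /image_measure /pushforward preimage_set0 measure0. Qed.

Let image_measure_ge0 A : (0 <= image_measure mf A)%E.
Proof. by rewrite /image_measure /pushforward measure_ge0. Qed.

Let image_measure_sigma_additive : semi_sigma_additive (image_measure mf).
Proof. exact: measure_semi_sigma_additive. Qed.

HB.instance Definition _ := isMeasure.Build _ _ _ (image_measure mf)
  image_measure0 image_measure_ge0 image_measure_sigma_additive.

End image_measure.

Section lebesgue_tuple.
Context {R : realType}.

Definition tcons n (p : R * n.-tuple R) : n.+1.-tuple R :=
  [the n.+1.-tuple R of p.1 :: p.2].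

Lemma measurable_tcons n : measurable_fun setT (@tcons n).
Proof. exact: measurable_cons. Qed.

Section lebesgue_tcons.
Context n (mu : {sigma_finite_measure set (n.-tuple R) -> \bar R}).

Definition lebesgue_tcons : set (n.+1.-tuple R) -> \bar R :=
  image_measure (@lebesgue_measure R \x mu)%E (@measurable_tcons n).

HB.instance Definition _ := Measure.on lebesgue_tcons.

Let lebesgue_tcons_sigma_finite : sigma_finite setT lebesgue_tcons.
Proof.
have [F FT Foo] := sigma_finite_prod (@lebesgue_measure R) mu.
pose g (t : n.+1.-tuple R) : R * n.-tuple R := (thead t, [tuple of behead t]).
have mg : measurable_fun setT g.
  apply/measurable_fun_pairP; split.
    exact: (measurable_tnth ord0).
  exact: measurable_behead.
have tconsK : cancel (@tcons n) g.
  by move=> [x t]; congr pair; apply: val_inj.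
exists (fun k => g @^-1` F k).
  by rewrite -preimage_bigcup -FT.
move=> k; have [mFk Fkoo] := Foo k; split.
  by rewrite -[X in measurable X]setTI; exact: mg.
rewrite /lebesgue_tcons /image_measure /pushforward (_ : _ @^-1` _ = F k)//.
by apply/seteqP; split=> p /=; rewrite tconsK.
Qed.

HB.instance Definition _ := Measure_isSigmaFinite.Build _ _ _ lebesgue_tcons
  lebesgue_tcons_sigma_finite.

End lebesgue_tcons.

(* n-dimensional Lebesgue measure on the Borel sets of R^n. *)
Fixpoint lebesgue_tuple n : {sigma_finite_measure set (n.-tuple R) -> \bar R} :=
  match n with
  | 0 => dirac ([tuple] : 0.-tuple R)
  | m.+1 => lebesgue_tcons (lebesgue_tuple m)
  end.

End lebesgue_tuple.

Section simplex.
Context {R : realType}.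

Definition simplex n : set (n.-tuple R) :=
  [set f | (forall i, 0 <= tnth f i) /\ \sum_i tnth f i = 1].

Let measurable_coord_sum n :
  measurable_fun setT (fun f : n.-tuple R => \sum_i tnth f i).
Proof.
apply: (@measurable_sum _ _ _ _ _ _ (fun i (f : n.-tuple R) => tnth f i)) => i.
exact: measurable_tnth.
Qed.

Lemma measurable_simplex n : measurable (@simplex n).
Proof.
rewrite (_ : @simplex n = (\bigcap_(i in [set: 'I_n])
    (fun f : n.-tuple R => tnth f i) @^-1` `[0, +oo[) `&`
    (fun f : n.-tuple R => \sum_i tnth f i) @^-1` [set 1]).
  apply: measurableI.
    apply: fin_bigcap_measurable => //= i _.
    by rewrite -[X in measurable X]setTI; exact: measurable_tnth.
  by rewrite -[X in measurable X]setTI; exact: measurable_coord_sum.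
apply/seteqP; split => f /=.
  by move=> [f0 f1]; split => // i _ /=; rewrite in_itv/= f0.
move=> [f0 f1]; split => // i.
by have /= := f0 i Logic.I; rewrite in_itv/= andbT.
Qed.

Definition hyperplane_chart n (v : n.-tuple R) : n.+1.-tuple R :=
  tcons (1 - \sum_i tnth v i, v).

Lemma measurable_hyperplane_chart n :
  measurable_fun setT (@hyperplane_chart n).
Proof.
apply: measurable_cons; last exact: measurable_id.
exact: (measurable_funB (@measurable_cst _ _ _ R setT 1)
          (@measurable_coord_sum n)).
Qed.

(* n-dimensional Lebesgue measure of the hyperplane f_0 + ... + f_n = 1 of
   R^(n+1). The hyperplane is the graph of an affine function of the last n
   coordinates, with gradient (-1, ..., -1), whence the area factor
   sqrt (1 + n). *)
Definition hyperplane_lebesgue n :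
    {measure set (n.+1.-tuple R) -> \bar R} :=
  mscale (Num.sqrt n.+1%:R)%:nng
    (image_measure (lebesgue_tuple n) (@measurable_hyperplane_chart n)).

(* The uniform probability measure of the simplex of R^(n+1), as a measure on
   the ambient space. The simplex has mass sqrt (n + 1) / n!, so the Dirac
   measure, the default of mnormalize for masses 0 and +oo, plays no role. *)
Definition uniform_simplex n : probability (n.+1.-tuple R) R :=
  mnormalize (mrestr (hyperplane_lebesgue n) (@measurable_simplex n.+1))
    (dirac (hyperplane_chart [tuple of nseq n 0])).

End simplex.
Arguments simplex : clear implicits.
Arguments uniform_simplex : clear implicits.

Section earth_mover.
Context {R : realType} {n : nat}.

Definition couplings (mu nu : n.-tuple R) : set 'M[R]_n :=
  [set J | [/\ forall i j, 0 <= J i j,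
               forall j, \sum_i J i j = tnth mu j
             & forall i, \sum_j J i j = tnth nu i]].

(* Indices run over 0..n-1 instead of 1..n, which leaves |i - j| unchanged.
   Pairs with no coupling (inf set0 = 0) lie outside the product of simplices,
   hence in a null set of uniform_simplex \x uniform_simplex. *)
Definition EMD (mu nu : n.-tuple R) : R :=
  inf [set \sum_(i < n) \sum_(j < n) `|i%:R - j%:R| * J i j
      | J in couplings mu nu].

End earth_mover.

Section mean_EMD.
Context {R : realType}.

Fixpoint mean_EMD (p : nat) : nat -> R :=
  match p with
  | 0 => fun=> 0
  | p'.+1 => fix mean_EMD_p (q : nat) : R :=
    match q with
    | 0 => 0
    | q'.+1 => (p'%:R * mean_EMD p' q + q'%:R * mean_EMD_p q' +
                `|p%:R - q%:R|) / (p%:R + q%:R - 1)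
    end
  end.

Lemma mean_EMD0l q : mean_EMD 0 q = 0.
Proof. by []. Qed.

Lemma mean_EMD0r p : mean_EMD p 0 = 0.
Proof. by case: p. Qed.

Lemma mean_EMD_rec p q : (0 < p)%N -> (0 < q)%N ->
  mean_EMD p q = ((p%:R - 1) * mean_EMD p.-1 q + (q%:R - 1) * mean_EMD p q.-1 +
                  `|p%:R - q%:R|) / (p%:R + q%:R - 1).
Proof.
case: p q => // p [//|q] _ _.
by rewrite -[in p.+1%:R - 1]natr1 -[in q.+1%:R - 1]natr1 !addrK.
Qed.

End mean_EMD.
Arguments mean_EMD : clear implicits.

(* Main.v *)
(* On the line the optimal transport is monotone, so EMD(mu, nu) is the l^1
   distance of the cumulative distribution functions. Under the uniform law of
   the simplex of R^(n+1), the tail sum of the last l coordinates is at most c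
   with probability P(B >= l), where B is binomial of parameters n and c. Since
   E|X - Y| is the integral of 2 P(X <= c) P(c < X) over c for independent
   copies X and Y, summing over l shows that the expected EMD is the integral
   over c in [0, 1] of E|B - B'|. Beta integrals turn it into the mean of the
   sum of |i - j| over a random lattice path from (0, 0) to (n, n), divided by
   2n + 1, and conditioning a path to (m, r) on its last step gives the
   recursion. *)
Require Import Defs.
From HB Require Import structures.
From mathcomp Require Import all_boot all_order all_algebra.
From mathcomp Require Import all_classical all_reals all_analysis.
From mathcomp Require Import measurable_realfun ring lra zify.

Import Order.TTheory GRing.Theory Num.Theory.
Import numFieldNormedType.Exports.

Set Implicit Arguments.
Unset Strict Implicit.
Unset Printing Implicit Defensive.

Local Open Scope classical_set_scope.
Local Open Scope ring_scope.

(** * Random lattice paths *)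

Section shuffle.
Context {R : realType}.

(* The probability that a uniformly random monotone lattice path from (0, 0) to
   (m, r) passes through (i, j); the recurrence below conditions on the last
   step of the path, which comes from (m - 1, r) with probability m / (m + r). *)
Definition shuffle_weight (m r i j : nat) : R :=
  ('C(m, i) * 'C(r, j) * ((i + j)`! * (m + r - (i + j))`!))%N%:R
    / (m + r)`!%:R.

Lemma shuffle_weight_max m r : shuffle_weight m r m r = 1.
Proof.
by rewrite /shuffle_weight !binn subnn fact0 !mul1n muln1 divff// pnatr_eq0 -lt0n fact_gt0.
Qed.

Lemma shuffle_weight_gt m r i j : (m < i)%N || (r < j)%N ->
  shuffle_weight m r i j = 0.
Proof.
by move=> /orP[] h; rewrite /shuffle_weight (bin_small h) ?(muln0, mul0n) mul0r.
Qed.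

(** A path visits a point other than its endpoint before its last step, so that visit belongs to a
    path to one of the two predecessors. The indicator accounts for the endpoint itself, which every
    path visits. *)
Lemma shuffle_weight_rec m r i j : (i <= m)%N -> (j <= r)%N ->
  (m + r)%:R * shuffle_weight m r i j =
  m%:R * shuffle_weight m.-1 r i j + r%:R * shuffle_weight m r.-1 i j
  + ((i == m) && (j == r))%:R * (m + r)%:R.
Proof.
move=> im jr; case: (boolP ((i == m) && (j == r))) => [/andP[/eqP -> /eqP ->]|nij].
  rewrite shuffle_weight_max mulr1 mul1r.
  suff [-> ->] : m%:R * shuffle_weight m.-1 r m r = 0
    /\ r%:R * shuffle_weight m r.-1 m r = 0 by rewrite !add0r.
  split.
    case: m {im} => [|m]; first by rewrite mul0r.
    by rewrite shuffle_weight_gt ?mulr0// ltnSn.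
  case: r {jr} => [|r]; first by rewrite mul0r.
  by rewrite shuffle_weight_gt ?mulr0// ltnSn orbT.
rewrite mul0r addr0.
have ijmr : (i + j < m + r)%N.
  by move: nij; rewrite negb_and => /orP[] /eqP; lia.
(* Away from the endpoint at least one step remains after [(i, j)]; [k] counts the remaining steps
   except the last. *)
have [k mrE] : exists k, (m + r = (i + j + k).+1)%N by exists (m + r - (i + j)).-1; lia.
have mrk : (m + r - (i + j) = k.+1)%N by lia.
have Hm : m%:R * shuffle_weight m.-1 r i j
    = ((m - i) * 'C(m, i) * 'C(r, j) * ((i + j)`! * k`!))%N%:R / (i + j + k)`!%:R :> R.
  rewrite -mul_bin_down; case: m im mrE {mrk nij ijmr} => [|m] im mrE.
    by rewrite !mul0n !mul0r.
  rewrite /shuffle_weight /= mulrA -natrM.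
  by rewrite (_ : (m + r = i + j + k)%N) ?addKn ?mulnA//; lia.
have Hr : r%:R * shuffle_weight m r.-1 i j
    = ((r - j) * 'C(r, j) * 'C(m, i) * ((i + j)`! * k`!))%N%:R / (i + j + k)`!%:R :> R.
  rewrite -mul_bin_down; case: r jr mrE {mrk nij ijmr Hm} => [|r] jr mrE.
    by rewrite !mul0n !mul0r.
  rewrite /shuffle_weight /= mulrA -natrM.
  rewrite (_ : (m + r = i + j + k)%N); last by lia.
  by rewrite addKn (mulnC 'C(m, i)) !mulnA.
rewrite Hm Hr -mulrDl -natrD /shuffle_weight mrk mrE.
rewrite !factS !natrM.
have f0 : (i + j + k)`!%:R != 0 :> R by rewrite pnatr_eq0 -lt0n fact_gt0.
have s0 : (i + j + k).+1%:R != 0 :> R by rewrite pnatr_eq0.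
have -> : ((m - i) * 'C(m, i) * 'C(r, j) * ((i + j)`! * k`!) +
   (r - j) * 'C(r, j) * 'C(m, i) * ((i + j)`! * k`!) =
   'C(m, i) * 'C(r, j) * ((i + j)`! * (k.+1 * k`!)))%N.
  rewrite (_ : k.+1 = (m - i) + (r - j))%N; last by lia.
  by lia.
rewrite !natrM; field; apply/andP; split => //.
Qed.

(** By linearity, the mean over random paths to [(m, r)] of the sum of [|i - j|] over the visited
    points, both ends included. *)
Definition shuffle_sum (m r : nat) : R :=
  \sum_(i < m.+1) \sum_(j < r.+1) `|i%:R - j%:R| * shuffle_weight m r i j.

Lemma shuffle_sum_rec m r :
  (m + r)%:R * shuffle_sum m r =
  m%:R * shuffle_sum m.-1 r + r%:R * shuffle_sum m r.-1
  + (m + r)%:R * `|m%:R - r%:R|.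
Proof.
have -> : m%:R * shuffle_sum m.-1 r = \sum_(i < m.+1) \sum_(j < r.+1)
    `|i%:R - j%:R| * (m%:R * shuffle_weight m.-1 r i j).
  rewrite /shuffle_sum; case: m => [|m] /=.
    by rewrite mul0r !big1// => i _; rewrite big1// => j _; rewrite mul0r mulr0.
  rewrite [RHS]big_ord_recr/= [X in _ + X]big1 ?addr0; last first.
    by move=> j _; rewrite shuffle_weight_gt ?ltnSn// !mulr0.
  by rewrite mulr_sumr; apply: eq_bigr => i _; rewrite mulr_sumr;
    apply: eq_bigr => j _; rewrite mulrCA.
have -> : r%:R * shuffle_sum m r.-1 = \sum_(i < m.+1) \sum_(j < r.+1)
    `|i%:R - j%:R| * (r%:R * shuffle_weight m r.-1 i j).
  rewrite /shuffle_sum mulr_sumr; apply: eq_bigr => i _.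
  case: r => [|r] /=.
    by rewrite mul0r !big1// => j _; rewrite mul0r mulr0.
  rewrite [RHS]big_ord_recr/= shuffle_weight_gt ?ltnSn ?orbT// !mulr0 addr0.
  by rewrite mulr_sumr; apply: eq_bigr => j _; rewrite mulrCA.
have -> : (m + r)%:R * `|m%:R - r%:R| = \sum_(i < m.+1) \sum_(j < r.+1)
    `|i%:R - j%:R| * (((i == m :> nat) && (j == r :> nat))%:R * (m + r)%:R) :> R.
  rewrite big_ord_recr/= big1 ?add0r; last first.
    move=> i _; rewrite big1// => j _.
    by rewrite (ltn_eqF (ltn_ord i)) mul0r mulr0.
  rewrite big_ord_recr/= big1 ?add0r; last first.
    by move=> j _; rewrite (ltn_eqF (ltn_ord j)) andbF mul0r mulr0.
  by rewrite !eqxx mul1r mulrC.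
rewrite -!big_split/= mulr_sumr; apply: eq_bigr => i _.
rewrite -!big_split/= mulr_sumr; apply: eq_bigr => j _.
by rewrite mulrCA shuffle_weight_rec -1?ltnS// !mulrDr.
Qed.

(** A path to [(m, r)] visits [m + r + 1] points, so the right-hand side is the mean of [|i - j|]
    along the path. With indices shifted by one, [m + r + 1] is the denominator [p + q - 1], and
    both sides obey the same recursion. *)
Lemma mean_EMD_shuffle m r :
  mean_EMD R m.+1 r.+1 = shuffle_sum m r / (m + r).+1%:R.
Proof.
have [N] := ubnP (m + r); elim: N m r => // N IH m r; rewrite ltnS => mrN.
rewrite mean_EMD_rec// -[m.+1.-1]/m -[r.+1.-1]/r; have [mr0|mr0] := eqVneq (m + r)%N 0%N.
  have [-> ->] : m = 0%N /\ r = 0%N by lia.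
  rewrite /shuffle_sum !big_ord1 mean_EMD0r mean_EMD0l !subrr normr0.
  by rewrite !mul0r !addr0 ?mul0r.
have mr0' : (m + r)%:R != 0 :> R by rewrite pnatr_eq0.
have mr1' : (m + r).+1%:R != 0 :> R by rewrite pnatr_eq0.
have -> : m.+1%:R + r.+1%:R - 1 = (m + r).+1%:R :> R.
  by rewrite -!natr1 natrD; ring.
congr (_ / _); apply: (mulfI mr0').
have subS (k : nat) : k.+1%:R - 1 = k%:R :> R by rewrite -natr1 addrK.
rewrite shuffle_sum_rec !subS.
have -> : `|m.+1%:R - r.+1%:R| = `|m%:R - r%:R| :> R.
  by congr `|_|; rewrite -!natr1; ring.
have -> : m%:R * mean_EMD R m r.+1 = m%:R * (shuffle_sum m.-1 r / (m + r)%:R).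
  case: m mr0 mr0' mrN {mr1'} => [|m] mr0 mr0' mrN; first by rewrite !mul0r.
  by rewrite IH//; lia.
have -> : r%:R * mean_EMD R m.+1 r = r%:R * (shuffle_sum m r.-1 / (m + r)%:R).
  case: r mr0 mr0' mrN {mr1'} => [|r] mr0 mr0' mrN; first by rewrite !mul0r.
  by rewrite addnS IH//; lia.
by field; rewrite -natrD.
Qed.

End shuffle.

(** * Transport on the line *)

Section earth_mover_formula.
Context {R : realType} {n : nat}.
Implicit Types f mu nu : n.-tuple R.

Definition cumul f (k : nat) : R := \sum_(i < n | (i < k)%N) tnth f i.

Lemma cumul0 f : cumul f 0 = 0.
Proof. by rewrite /cumul big_pred0. Qed.

Lemma cumul_max f : cumul f n = \sum_i tnth f i.
Proof. by apply: eq_bigl => i; rewrite ltn_ord. Qed.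

Lemma cumulS f (i : 'I_n) : cumul f i.+1 = cumul f i + tnth f i.
Proof.
rewrite /cumul (bigD1 i)//= addrC; congr (_ + _); apply: eq_bigl => j.
by rewrite ltnS ltn_neqAle andbC.
Qed.

Lemma le_cumul f (a b : nat) : (forall i, 0 <= tnth f i) -> (a <= b)%N ->
  cumul f a <= cumul f b.
Proof.
move=> f0 ab; rewrite /cumul [leLHS]big_mkcond [leRHS]big_mkcond /=.
apply: ler_sum => i _; case: ifPn => [ia|_]; last by case: ifP.
by rewrite (leq_trans ia ab).
Qed.

(** The summand is 1 exactly when the cut between [k] and [k + 1] separates [i] from [j], and there
    are [|i - j|] such cuts. *)
Lemma distn_sum_ord (i j : 'I_n) :
  `|i%:R - j%:R| = \sum_(k < n) `|(j <= k)%:R - (i <= k)%:R| :> R.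
Proof.
have sum_le (a : 'I_n) : \sum_(k < n) (a <= k)%:R = n%:R - a%:R :> R.
  rewrite -natr_sum -natrB 1?ltnW//; congr (_%:R).
  elim: n (a : nat) => [|m IH] b; first by rewrite big_ord0.
  by rewrite big_ord_recr/= IH; case: leqP; lia.
wlog ij : i j / (i <= j)%N => [hw|].
  have [/hw//|/ltnW/hw ji] := leqP i j.
  by rewrite distrC ji; apply: eq_bigr => k _; rewrite distrC.
rewrite distrC ger0_norm ?subr_ge0 ?ler_nat//.
transitivity (\sum_(k < n) ((i <= k)%:R - (j <= k)%:R) : R).
  by rewrite sumrB !sum_le; ring.
apply: eq_bigr => k _; rewrite distrC ger0_norm// subr_ge0 ler_nat.
by case: (leqP j k) => // jk; rewrite (leq_trans ij jk).
Qed.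

Lemma cost_cumul (J : 'M[R]_n) :
  \sum_(i < n) \sum_(j < n) `|i%:R - j%:R| * J i j =
  \sum_(k < n) \sum_(i < n) \sum_(j < n) `|(j <= k)%:R - (i <= k)%:R| * J i j.
Proof.
rewrite [RHS]exchange_big; apply: eq_bigr => i _ /=.
rewrite [RHS]exchange_big; apply: eq_bigr => j _ /=.
by rewrite -mulr_suml -distn_sum_ord.
Qed.

Lemma coupling_cumul mu nu (J : 'M[R]_n) (k : nat) : couplings mu nu J ->
  cumul mu k.+1 = \sum_(i < n) \sum_(j < n) (j <= k)%:R * J i j
  /\ cumul nu k.+1 = \sum_(i < n) \sum_(j < n) (i <= k)%:R * J i j.
Proof.
move=> [_ Jmu Jnu]; split; rewrite /cumul big_mkcond.
  rewrite exchange_big; apply: eq_bigr => j _ /=.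
  by rewrite -mulr_sumr Jmu ltnS; case: ifP; rewrite ?mul1r ?mul0r.
apply: eq_bigr => i _ /=.
by rewrite -mulr_sumr Jnu ltnS; case: ifP; rewrite ?mul1r ?mul0r.
Qed.

(** The cost is the total mass moved across all cuts. By the triangle inequality, the mass crossing
    a cut is at least the difference of the masses that [mu] and [nu] put below it. *)
Lemma le_cumul_cost mu nu (J : 'M[R]_n) : couplings mu nu J ->
  \sum_(k < n) `|cumul mu k.+1 - cumul nu k.+1| <=
  \sum_(i < n) \sum_(j < n) `|i%:R - j%:R| * J i j.
Proof.
move=> cJ; rewrite cost_cumul; apply: ler_sum => k _.
have [-> ->] := coupling_cumul k cJ; case: cJ => J0 _ _.
rewrite -sumrB (le_trans (ler_norm_sum _ _ _))//; apply: ler_sum => i _.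
rewrite -sumrB (le_trans (ler_norm_sum _ _ _))//; apply: ler_sum => j _.
by rewrite -mulrBl normrM (ger0_norm (J0 _ _)).
Qed.

Section monotone_coupling.
Variables mu nu : n.-tuple R.
Hypotheses (mu0 : forall i, 0 <= tnth mu i) (nu0 : forall i, 0 <= tnth nu i).
Hypothesis munu : \sum_i tnth mu i = \sum_i tnth nu i.

Let H (a b : nat) : R := Num.min (cumul nu a) (cumul mu b).

(* The joint distribution function of the monotone coupling is the minimum of
   the two distribution functions; its second difference is the coupling. *)
Definition monotone_coupling : 'M[R]_n :=
  \matrix_(i, j) (H i.+1 j.+1 - H i j.+1 - (H i.+1 j - H i j)).

Let sum_diff (F : nat -> R) (k : nat) : (k <= n)%N ->
  \sum_(i < n | (i < k)%N) (F i.+1 - F i) = F k - F 0%N.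
Proof.
move=> kn; rewrite -(big_ord_widen _ (fun i => F i.+1 - F i))//.
by rewrite -(big_mkord xpredT (fun i => F i.+1 - F i)) telescope_sumr.
Qed.

Let H0l b : H 0 b = 0.
Proof. by rewrite /H cumul0 min_l// -(cumul0 mu); exact: le_cumul. Qed.

Let H0r a : H a 0 = 0.
Proof. by rewrite /H cumul0 min_r// -(cumul0 nu); exact: le_cumul. Qed.

Let sum_row (k : nat) (i : 'I_n) : (k <= n)%N ->
  \sum_(j < n | (j < k)%N) monotone_coupling i j = H i.+1 k - H i k.
Proof.
move=> kn; under eq_bigr do rewrite mxE.
apply: etrans (sum_diff (fun j => H i.+1 j - H i j) kn) _.
by rewrite !H0r !subr0.
Qed.

Let sum_col (k : nat) (j : 'I_n) : (k <= n)%N ->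
  \sum_(i < n | (i < k)%N) monotone_coupling i j = H k j.+1 - H k j.
Proof.
move=> kn; under eq_bigr do rewrite mxE.
apply: etrans (etrans _ (sum_diff (fun i => H i j.+1 - H i j) kn)) _.
  by apply: eq_bigr => i _; ring.
by rewrite !H0l !subr0.
Qed.

Let sum_rect (k : nat) : (k <= n)%N ->
  \sum_(i < n) \sum_(j < n) ((i < k)%:R * (j < k)%:R) * monotone_coupling i j
  = H k k.
Proof.
move=> kn.
transitivity (\sum_(i < n | (i < k)%N) (H i.+1 k - H i k)).
  rewrite [RHS]big_mkcond/=; apply: eq_bigr => i _.
  case: ifPn => ik; last by rewrite big1// => j _; rewrite !mul0r.
  rewrite -sum_row// [RHS]big_mkcond/=; apply: eq_bigr => j _.
  by case: ifPn; rewrite ?(mul0r, mul1r, mulr0).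
by rewrite (sum_diff (fun i => H i k))// H0l subr0.
Qed.

Lemma monotone_couplingP : couplings mu nu monotone_coupling.
Proof.
have munu' : cumul mu n = cumul nu n by rewrite !cumul_max.
have mun k : (k <= n)%N -> H n k = cumul mu k.
  by move=> kn; rewrite /H min_r// -munu'; exact: le_cumul.
have nun k : (k <= n)%N -> H k n = cumul nu k.
  by move=> kn; rewrite /H min_l// munu'; exact: le_cumul.
split=> [i j|j|i].
(* Both cumulative sums increase, so their minimum has a non-negative second difference; this is
   checked for each outcome of the four comparisons. *)
- rewrite mxE /H.
  have nui := le_cumul nu0 (leqnSn i); have muj := le_cumul mu0 (leqnSn j).
  by case: (leP (cumul nu i.+1) (cumul mu j.+1)) => ?;
    case: (leP (cumul nu i) (cumul mu j.+1)) => ?;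
    case: (leP (cumul nu i.+1) (cumul mu j)) => ?;
    case: (leP (cumul nu i) (cumul mu j)) => ?; lra.
- rewrite -[LHS](eq_bigl _ _ (fun i => ltn_ord i)) sum_col//.
  by rewrite !mun// 1?ltnW// cumulS addrC addKr.
- rewrite -[LHS](eq_bigl _ _ (fun j => ltn_ord j)) sum_row//.
  by rewrite !nun// 1?ltnW// cumulS addrC addKr.
Qed.

(** For indicators, [|a - b| = a + b - 2ab]. Hence the mass crossing a cut is the sum of the two
    cumulative sums minus twice their minimum, which is their distance: the lower bound is
    attained. *)
Lemma cost_monotone_coupling :
  \sum_(i < n) \sum_(j < n) `|i%:R - j%:R| * monotone_coupling i j =
  \sum_(k < n) `|cumul mu k.+1 - cumul nu k.+1|.
Proof.
rewrite cost_cumul; apply: eq_bigr => k _.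
transitivity (cumul mu k.+1 + cumul nu k.+1 - 2 * H k.+1 k.+1).
  have [-> ->] := coupling_cumul k monotone_couplingP.
  rewrite -sum_rect// mulr_sumr -big_split -sumrB; apply: eq_bigr => i _ /=.
  rewrite mulr_sumr -big_split -sumrB; apply: eq_bigr => j _ /=.
  rewrite !ltnS; case: (i <= k)%N; case: (j <= k)%N => /=;
    rewrite ?subrr ?subr0 ?sub0r ?normrN ?normr0 ?normr1; ring.
rewrite /H minEle; case: leP => h.
  by rewrite ger0_norm ?subr_ge0//; ring.
by rewrite ltr0_norm ?subr_lt0//; ring.
Qed.

Lemma EMD_cumul : EMD mu nu = \sum_(k < n) `|cumul mu k.+1 - cumul nu k.+1|.
Proof.
apply/eqP; rewrite eq_le; apply/andP; split.
  rewrite -cost_monotone_coupling; apply: ge_inf.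
    exists (\sum_(k < n) `|cumul mu k.+1 - cumul nu k.+1|) => _ [J cJ <-].
    exact: le_cumul_cost.
  by exists monotone_coupling => //; exact: monotone_couplingP.
apply: lb_le_inf.
  by eexists; exists monotone_coupling => //; exact: monotone_couplingP.
by move=> _ [J cJ <-]; exact: le_cumul_cost.
Qed.

End monotone_coupling.

(** The marginals of a non-negative matrix are non-negative and have equal totals; otherwise the
    infimum is over the empty set. This value serves to prove [EMD] measurable on the whole
    space. *)
Lemma EMD_no_coupling mu nu :
  ~ [/\ forall i, 0 <= tnth mu i, forall i, 0 <= tnth nu i
      & \sum_i tnth mu i = \sum_i tnth nu i] ->
  EMD mu nu = 0.
Proof.
move=> nc; rewrite /EMD (_ : couplings mu nu = set0) ?image_set0 ?inf0//.
apply/seteqP; split=> // J [J0 Jmu Jnu]; apply: nc; split.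
- by move=> j; rewrite -Jmu sumr_ge0.
- by move=> i; rewrite -Jnu sumr_ge0.
under eq_bigr do rewrite -Jmu.
by rewrite exchange_big; under [RHS]eq_bigr do rewrite -Jnu.
Qed.

End earth_mover_formula.

(** * Volumes of truncated corners *)

Section divided_power.
Context {R : realType}.
Implicit Types (x s c : R).
Notation mu := (@lebesgue_measure R).

(** The divided power: for [x >= 0], the volume of the set of non-negative vectors of R^k with sum
    at most [x]. Integration raises the degree without producing constants. *)
Definition dpow (k : nat) x : R := x ^+ k / k`!%:R.

Lemma dpow_ge0 k x : 0 <= x -> 0 <= dpow k x.
Proof. by move=> x0; rewrite divr_ge0// exprn_ge0. Qed.

Lemma dpow0n k : dpow k 0 = (k == 0%N)%:R.
Proof. by rewrite /dpow expr0n; case: k => [|k]; rewrite ?fact0 ?divr1// mul0r. Qed.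

Lemma dpow0 x : dpow 0 x = 1.
Proof. by rewrite /dpow fact0 divr1. Qed.

Lemma is_derive_dpow k d x :
  is_derive x 1 (fun y => - dpow k.+1 (d - y)) (dpow k (d - x)).
Proof.
have f0 : k.+1`!%:R != 0 :> R by rewrite pnatr_eq0 -lt0n fact_gt0.
have dB : is_derive x 1 (fun y => d - y) (-1).
  have := is_deriveB (is_derive_cst d x 1) (is_derive_id x 1).
  by rewrite sub0r.
have := is_deriveZ (- k.+1`!%:R^-1) (is_deriveX k.+1 dB).
rewrite (_ : _ \*: _ = (fun y => - dpow k.+1 (d - y))); last first.
  apply/funext => y; rewrite /dpow/= /GRing.scale/= mulNr mulrC.
  by rewrite exprfctE.
move=> h; apply: is_derive_eq.
rewrite /GRing.scale/= /dpow factS natrM invfM.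
by field; rewrite pnatr_eq0 -lt0n fact_gt0 nat1r pnatr_eq0.
Qed.

Lemma measurable_dpow k d D : measurable_fun D (fun x => dpow k (d - x)).
Proof.
apply: measurable_funM => //; apply: measurable_funX.
exact: measurable_funB.
Qed.

Lemma integral_dpow k d a b : a <= b ->
  (\int[mu]_(x in `[a, b]) (dpow k (d - x))%:E =
    (dpow k.+1 (d - a) - dpow k.+1 (d - b))%:E)%E.
Proof.
rewrite le_eqVlt => /predU1P[<-|ab].
  by rewrite set_itv1 integral_set1 subrr.
have cF j : continuous (fun x => - dpow j.+1 (d - x)).
  move=> x; apply: differentiable_continuous; apply/derivable1_diffP.
  by have [] := is_derive_dpow j d x.
rewrite (@continuous_FTC2 _ _ (fun x => - dpow k.+1 (d - x)))//.
- by rewrite -EFinB; congr EFin; ring.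
- apply: continuous_subspaceT => x; case: k => [|k].
    rewrite (_ : (fun _ => _) = cst 1); first exact: cvg_cst.
    by apply/funext => y; rewrite dpow0.
  rewrite (_ : (fun _ => _) = - (fun x => - dpow k.+1 (d - x))).
    by apply: continuousN; exact: cF.
  by apply/funext => y; rewrite /= opprK.
- split.
  + by move=> x _; have [] := is_derive_dpow k d x.
  + by apply: cvg_at_right_filter; exact: cF.
  + by apply: cvg_at_left_filter; exact: cF.
- by move=> x _; rewrite derive1E; have [_ ->] := is_derive_dpow k d x.
Qed.

End divided_power.

Section corner_volume.
Context {R : realType}.
Implicit Types (x s c : R).
Notation mu := (@lebesgue_measure R).

(** The product measure integrates the measures of the sections over the first coordinate, and the
    sections outside [[0, s]] are empty. *)
Lemma lebesgue_tuple_slice N s (C : set (N.+1.-tuple R))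
    (B : R -> set (N.-tuple R)) :
  (forall x v, C (tcons (x, v)) <-> x \in `[0, s] /\ B x v) ->
  (lebesgue_tuple N.+1 C = \int[mu]_(x in `[0%R, s]) lebesgue_tuple N (B x))%E.
Proof.
move=> CB; rewrite [RHS]integral_mkcond; apply: eq_integral => x _ /=.
rewrite patchE mem_setE; case: ifPn => xs.
  congr (lebesgue_tuple N _); apply/seteqP; split => v /=.
    by rewrite /xsection/= inE => /CB[].
  by rewrite /xsection/= inE => Bv; apply/CB.
rewrite (_ : xsection _ _ = set0) ?measure0//.
apply/seteqP; split => v //=; rewrite /xsection/= inE => /CB[].
by rewrite (negbTE xs).
Qed.

(** For [s = 1] this is, in the chart of the simplex, the event that the mass beyond the first
    [k + 1] coordinates is at most [c]. The bound [c] ignores the first [k] entries, which can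
    therefore be integrated out one at a time. *)
Definition truncated_corner N k s c : set (N.-tuple R) :=
  [set v | [/\ all (fun x => 0 <= x) v, \sum_(x <- v) x <= s
             & \sum_(x <- drop k v) x <= c]].

Lemma truncated_corner_cons N k s c x (v : N.-tuple R) :
  truncated_corner k.+1 s c (tcons (x, v)) <->
  x \in `[0, s] /\ truncated_corner k (s - x) c v.
Proof.
rewrite /truncated_corner /= big_cons in_itv/=; split.
  move=> [/andP[x0 v0] xs vc]; rewrite x0/=.
  have vge0 : 0 <= \sum_(y <- v) y.
    by rewrite big_seq sumr_ge0// => y yv; exact: (allP v0).
  by split; [lra | split => //; lra].
by move=> [/andP[x0 xs] [v0 vs vc]]; split => //; [exact/andP|lra].
Qed.

Lemma truncated_corner0_cons N s c x (v : N.-tuple R) :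
  truncated_corner 0 s c (tcons (x, v)) <->
  x \in `[0, Num.min s c] /\ truncated_corner 0 (Num.min s c - x) (Num.min s c - x) v.
Proof.
rewrite /truncated_corner /= !drop0 big_cons in_itv/= le_min; split.
  move=> [/andP[x0 v0] xs vc]; rewrite x0/=.
  have vge0 : 0 <= \sum_(y <- v) y.
    by rewrite big_seq sumr_ge0// => y yv; exact: (allP v0).
  rewrite lerBrDl le_min xs vc; split => //; apply/andP; split; lra.
rewrite lerBrDl le_min => -[/and3P[x0 xs xc] [v0 /andP[vs vc] _]].
by split => //; apply/andP.
Qed.

Lemma lebesgue_corner N s c : 0 <= s -> 0 <= c ->
  lebesgue_tuple N (truncated_corner 0 s c) = (dpow N (Num.min s c))%:E.
Proof.
elim: N s c => [|N IH] s c s0 c0.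
  rewrite dpow0 /= /dirac/= indicE mem_set//.
  by split; rewrite ?drop0 ?big_nil.
rewrite (lebesgue_tuple_slice (@truncated_corner0_cons _ _ _)).
have m0 : 0 <= Num.min s c by rewrite le_min s0.
rewrite (@eq_integral _ _ R mu _ (fun x => (dpow N (Num.min s c - x))%:E)); last first.
  move=> x; rewrite mem_setE in_itv/= => /andP[x0 xm].
  by rewrite IH ?subr_ge0// minxx.
by rewrite integral_dpow// subr0 subrr dpow0n subr0.
Qed.

(** For [s = 1] and [0 <= c <= 1], [N!] times this sum is the binomial tail P(B >= l). The minimum
    and maximum extend the formula to [s <= c], where only the term [j = N] survives. *)
Definition corner_volume N l s c : R :=
  \sum_(l <= j < N.+1) dpow j (Num.min s c) * dpow (N - j) (Num.max (s - c) 0).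

Lemma corner_volume_le N l s c : (l <= N)%N -> s <= c ->
  corner_volume N l s c = dpow N s.
Proof.
move=> lN sc; rewrite /corner_volume big_nat_recr//= big_nat big1 => [|j jN].
  by rewrite add0r subnn dpow0 mulr1 min_l.
rewrite max_r ?subr_le0// dpow0n subn_eq0 leqNgt.
by move: jN => /andP[_ ->]; rewrite mulr0.
Qed.

(** If [s > c], the interval is split at [s - c]. On the left [s - x] still exceeds [c], and each
    second factor gains one degree; on the right the truncation is void, and the integral is the new
    top term [j = N + 1]. *)
Lemma integral_corner_volume N l s c : (l <= N)%N -> 0 <= s -> 0 <= c ->
  (\int[mu]_(x in `[0%R, s]) (corner_volume N l (s - x) c)%:E =
   (corner_volume N.+1 l s c)%:E)%E.
Proof.
move=> lN s0 c0; have [sc|cs] := leP s c.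
  rewrite (@eq_integral _ _ R mu _ (fun x => (dpow N (s - x))%:E)); last first.
    move=> x; rewrite mem_setE in_itv/= => /andP[x0 xs].
    by rewrite corner_volume_le//; lra.
  rewrite integral_dpow// corner_volume_le//; last exact: leqW.
  by rewrite subr0 subrr dpow0n subr0.
have intl : (\int[mu]_(x in `[0%R, (s - c)%R]) (corner_volume N l (s - x) c)%:E =
    (\sum_(l <= j < N.+1) dpow j c * dpow (N.+1 - j) (s - c))%:E)%E.
  pose f j x := ((dpow j c)%:E * (dpow (N - j) (s - c - x))%:E)%E.
  have f0 j x : x \in `[0, s - c] -> (0 <= f j x)%E.
    rewrite in_itv/= => /andP[x0 xsc].
    by rewrite /f -EFinM lee_fin mulr_ge0// dpow_ge0// subr_ge0.
  rewrite (@eq_integral _ _ R mu _ (fun x => (\sum_(l <= j < N.+1) f j x)%E)); last first.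
    move=> x; rewrite mem_setE in_itv/= => /andP[x0 xsc].
    rewrite /corner_volume -sumEFin; apply: eq_bigr => j _.
    by rewrite EFinM min_r ?max_l; [congr (_ * (dpow _ _)%:E)%E; ring|lra|lra].
  rewrite ge0_integral_sum//; last first.
    by move=> j; apply: measurable_funeM; apply/measurable_EFinP; exact: measurable_dpow.
  rewrite -sumEFin big_nat [RHS]big_nat; apply: eq_bigr => j /andP[_ jN].
  rewrite ge0_integralZl_EFin//=.
  - rewrite integral_dpow ?subr_ge0 1?ltW// subr0 subrr dpow0n subr0 -EFinM.
    by rewrite subSn.
  - move=> x; rewrite /= in_itv/= => /andP[x0 xsc].
    by rewrite lee_fin dpow_ge0// subr_ge0.
  - by apply/measurable_EFinP; exact: measurable_dpow.
  - by rewrite dpow_ge0.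
have intr : (\int[mu]_(x in `[(s - c)%R, s]) (corner_volume N l (s - x) c)%:E =
    (dpow N.+1 c)%:E)%E.
  rewrite (@eq_integral _ _ R mu _ (fun x => (dpow N (s - x))%:E)); last first.
    move=> x; rewrite mem_setE in_itv/= => /andP[x0 xs].
    by rewrite corner_volume_le//; lra.
  rewrite integral_dpow; last by lra.
  by rewrite subrr dpow0n subr0; congr (dpow _ _)%:E; ring.
have mvol : measurable_fun setT (fun x => (corner_volume N l (s - x) c)%:E).
  apply/measurable_EFinP; apply: measurable_sum => j.
  apply: measurable_funM; apply: measurable_funM => //; apply: measurable_funX.
    by apply: measurable_minr => //; exact: measurable_funB.
  by apply: measurable_maxr => //; apply: measurable_funB => //; exact: measurable_funB.
have itvE : `[0, s]%classic = `[0, s - c]%classic `|` `]s - c, s]%classic.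
  rewrite -itv_bndbnd_setU// bnd_simp; lra.
rewrite itvE ge0_integral_setU//=.
- rewrite integral_itv_obnd_cbnd; last exact: measurable_funTS.
  rewrite intl intr -EFinD /corner_volume [in RHS]big_nat_recr/=; last exact: leqW.
  rewrite min_r 1?ltW// max_l ?subr_ge0 1?ltW//.
  by rewrite subnn dpow0 mulr1.
- exact: measurable_funTS.
- move=> x xitv; have {xitv}xs : x <= s.
    by move: xitv => [] /=; rewrite in_itv/= => /andP[]; lra.
  rewrite lee_fin sumr_ge0// => j _; apply: mulr_ge0; apply: dpow_ge0.
    by rewrite le_min c0 subr_ge0 xs.
  by rewrite le_max lexx orbT.
- apply/disj_setPS => x [] /=; rewrite !in_itv/=; lra.
Qed.

Lemma lebesgue_truncated_corner N k s c : (k <= N)%N -> 0 <= s -> 0 <= c ->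
  lebesgue_tuple N (truncated_corner k s c) = (corner_volume N (N - k) s c)%:E.
Proof.
elim: k N s => [|k IH] N s kN s0 c0.
  rewrite subn0 lebesgue_corner// /corner_volume big_nat1 subnn dpow0.
  by rewrite mulr1.
case: N kN => // N kN; rewrite subSS -integral_corner_volume ?leq_subr//.
rewrite (lebesgue_tuple_slice (@truncated_corner_cons _ _ _ _)).
apply: eq_integral => x; rewrite mem_setE in_itv/= => /andP[x0 xs].
by rewrite IH// subr_ge0.
Qed.

End corner_volume.

(** * The law of the cumulative sums *)

Lemma mnormalizeE d (T : measurableType d) (R : realType)
    (m : {measure set T -> \bar R}) (P : probability T R) (r : R) (A : set T) :
  r != 0 -> m setT = r%:E -> mnormalize m P A = (m A * r^-1%:E)%E.
Proof. by move=> r0 mr; rewrite /mnormalize mr orbF eqe (negbTE r0). Qed.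

Section uniform_simplex_law.
Context {R : realType}.
Implicit Types (c : R) (n k : nat).

Lemma hyperplane_chart0 n (v : n.-tuple R) :
  tnth (hyperplane_chart v) ord0 = 1 - \sum_i tnth v i.
Proof. by rewrite (tnth_nth 0). Qed.

Lemma hyperplane_chartS n (v : n.-tuple R) i :
  tnth (hyperplane_chart v) (lift ord0 i) = tnth v i.
Proof. by rewrite !(tnth_nth 0). Qed.

Lemma cumul_hyperplane_chart n k (v : n.-tuple R) : (k <= n)%N ->
  cumul (hyperplane_chart v) k.+1 = 1 - \sum_(x <- drop k v) x.
Proof.
elim: k => [_|k IH kn].
  rewrite drop0 (cumulS (hyperplane_chart v) ord0) cumul0 add0r.
  by rewrite hyperplane_chart0 big_tuple.
have kv : (k < size v)%N by rewrite size_tuple.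
rewrite (cumulS (hyperplane_chart v) (Ordinal (kn : (k.+1 < n.+1)%N))) IH 1?ltnW//.
rewrite (drop_nth 0 kv) big_cons /hyperplane_chart (tnth_nth 0) /=.
by ring.
Qed.

Lemma simplex_hyperplane_chart n (v : n.-tuple R) :
  simplex R n.+1 (hyperplane_chart v) <->
  all (fun x => 0 <= x) v /\ \sum_(x <- v) x <= 1.
Proof.
rewrite [in X in _ <-> X]big_tuple; split.
  move=> [f0 _]; split.
    apply/all_tnthP => i; have := f0 (lift ord0 i).
    by rewrite hyperplane_chartS.
  by have := f0 ord0; rewrite hyperplane_chart0 subr_ge0.
move=> [/all_tnthP v0 v1]; split.
  move=> i; case: (unliftP ord0 i) => [j ->|->].
    by rewrite hyperplane_chartS.
  by rewrite hyperplane_chart0 subr_ge0.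
rewrite big_ord_recl hyperplane_chart0.
under [X in _ + X]eq_bigr do rewrite hyperplane_chartS.
by rewrite subrK.
Qed.

Lemma preimage_simplex n :
  @hyperplane_chart R n @^-1` simplex R n.+1 = truncated_corner 0 1 1.
Proof.
apply/seteqP; split => v /=;
  rewrite simplex_hyperplane_chart /truncated_corner /=.
  by move=> [v0 v1]; split => //; rewrite drop0.
by case.
Qed.

(** The area factor cancels in the normalization, and the corner in the chart has volume
    [1 / n!]. *)
Lemma uniform_simplexE n (A : set (n.+1.-tuple R)) :
  (uniform_simplex R n A =
   lebesgue_tuple n (@hyperplane_chart R n @^-1` (A `&` simplex R n.+1))
     * n`!%:R%:E)%E.
Proof.
have sq0 : Num.sqrt n.+1%:R != 0 :> R by rewrite sqrtr_eq0 -ltNge.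
have evE : mrestr (hyperplane_lebesgue n) (@measurable_simplex R n.+1) setT =
    (Num.sqrt n.+1%:R / n`!%:R)%:E.
  rewrite /mrestr setTI.
  transitivity ((Num.sqrt n.+1%:R)%:E *
    lebesgue_tuple n (@hyperplane_chart R n @^-1` simplex R n.+1))%E => //.
  by rewrite preimage_simplex lebesgue_corner// minxx /dpow expr1n mul1r EFinM.
have ev0 : Num.sqrt n.+1%:R / n`!%:R != 0 :> R.
  by rewrite mulf_neq0// invr_eq0 pnatr_eq0 -lt0n fact_gt0.
apply: etrans (mnormalizeE _ _ ev0 evE) _.
transitivity ((Num.sqrt n.+1%:R)%:E * lebesgue_tuple n
  (@hyperplane_chart R n @^-1` (A `&` simplex R n.+1)) *
  (Num.sqrt n.+1%:R / n`!%:R)^-1%:E)%E => //.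
rewrite [X in (X * _)%E]muleC -muleA -EFinM; congr (_ * _%:E)%E.
by rewrite invfM invrK mulrA divff// mul1r.
Qed.

Lemma uniform_simplex_cumul n k c : (k <= n)%N ->
  (uniform_simplex R n [set f | 1 - cumul f k.+1 <= c]%R =
   lebesgue_tuple n (truncated_corner k 1 c) * n`!%:R%:E)%E.
Proof.
move=> kn; rewrite uniform_simplexE; congr (lebesgue_tuple n _ * _)%E.
apply/seteqP; split => v /=;
  rewrite simplex_hyperplane_chart cumul_hyperplane_chart// subKr.
  by move=> [? []].
by move=> [].
Qed.

Lemma uniform_simplex_simplex n : uniform_simplex R n (simplex R n.+1) = 1%E.
Proof.
rewrite uniform_simplexE setIid preimage_simplex lebesgue_corner//.
by rewrite minxx /dpow expr1n mul1r -EFinM mulVf.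
Qed.

Definition bernstein n j c : R := 'C(n, j)%:R * (c ^+ j * (1 - c) ^+ (n - j)).

(** The probability that a binomial variable of parameters [n] and [c] is at least [l]. *)
Definition bernstein_tail n l c : R := \sum_(l <= j < n.+1) bernstein n j c.

Lemma uniform_simplex_cumul_lt0 n k c : (k <= n)%N -> c < 0 ->
  uniform_simplex R n [set f | 1 - cumul f k.+1 <= c] = 0%E.
Proof.
move=> kn c0; rewrite uniform_simplex_cumul// (_ : truncated_corner _ _ _ = set0).
  by rewrite measure0 mul0e.
apply/seteqP; split => // v [/allP v0 _ vc].
suff : 0 <= \sum_(x <- drop k v) x by lra.
by rewrite big_seq sumr_ge0// => x /mem_drop; exact: v0.
Qed.

Lemma uniform_simplex_cumul_ge1 n k c : (k <= n)%N -> 1 <= c ->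
  uniform_simplex R n [set f | 1 - cumul f k.+1 <= c] = 1%E.
Proof.
move=> kn c1; rewrite uniform_simplex_cumul// lebesgue_truncated_corner//; last by lra.
by rewrite corner_volume_le ?leq_subr// /dpow expr1n mul1r -EFinM mulVf.
Qed.

Lemma uniform_simplex_cumul_bernstein n k c : (k <= n)%N -> 0 <= c <= 1 ->
  uniform_simplex R n [set f | 1 - cumul f k.+1 <= c] =
  (bernstein_tail n (n - k) c)%:E.
Proof.
move=> kn /andP[c0 c1]; rewrite uniform_simplex_cumul// lebesgue_truncated_corner//.
rewrite -EFinM; congr EFin; rewrite /corner_volume mulr_suml.
rewrite big_nat [RHS]big_nat; apply: eq_bigr => j /andP[_ jn].
rewrite min_r// max_l ?subr_ge0// /dpow /bernstein.
rewrite -(bin_fact (_ : j <= n)%N)// !natrM.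
by field; rewrite !pnatr_eq0 -!lt0n !fact_gt0.
Qed.

Lemma sum_bernstein n c : \sum_(j < n.+1) bernstein n j c = 1.
Proof.
rewrite -[RHS](expr1n _ n) -[X in X ^+ _](subrK c 1) exprDn.
by apply: eq_bigr => j _; rewrite /bernstein -[RHS]mulr_natl [X in _ = _ * X]mulrC.
Qed.

End uniform_simplex_law.

(** * Mean absolute difference of two independent copies *)

Section layer_cake.
Context d (T : measurableType d) (R : realType) (P : probability T R).
Notation mu := (@lebesgue_measure R).

(* Fubini, applied to the region between the graphs of the minimum and of the
   maximum of [X x] and [X y]. *)
Lemma mean_abs_diff (X : T -> R) : measurable_fun setT X ->
  (\int[P \x P]_z `|X z.1 - X z.2|%:E =
   \int[mu]_c (P [set x | X x <= c]%R * P [set x | c < X x]%R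
               + P [set x | c < X x]%R * P [set x | X x <= c]%R))%E.
Proof.
move=> mX.
pose lo (z : T * T) := Num.min (X z.1) (X z.2).
pose hi (z : T * T) := Num.max (X z.1) (X z.2).
have mX1 : measurable_fun setT (fun z : T * T => X z.1).
  exact: measurableT_comp.
have mX2 : measurable_fun setT (fun z : T * T => X z.2).
  exact: measurableT_comp.
have mlo : measurable_fun setT lo by exact: measurable_minr.
have mhi : measurable_fun setT hi by exact: measurable_maxr.
pose D := [set p : (T * T) * R | lo p.1 <= p.2 /\ p.2 < hi p.1].
have mD : measurable D.
  rewrite (_ : D = (fun p => p.2 - lo p.1) @^-1` `[0, +oo[ `&`
      (fun p => hi p.1 - p.2) @^-1` `]0, +oo[).
    apply: measurableI; rewrite -[X in measurable X]setTI.
      have m : measurable_fun setT (fun p : (T * T) * R => p.2 - lo p.1).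
        by apply: measurable_funB => //; exact: measurableT_comp.
      exact: m.
    have m : measurable_fun setT (fun p : (T * T) * R => hi p.1 - p.2).
      by apply: measurable_funB => //; exact: measurableT_comp.
    exact: m.
  apply/seteqP; split => -[z c]; rewrite /D/= !in_itv/= !andbT subr_ge0 subr_gt0//.
transitivity (((P \x P) \x mu) D)%E.
  apply: eq_integral => z _ /=.
  rewrite (_ : xsection D z = `[lo z, hi z[%classic); last first.
    by apply/seteqP; split => c; rewrite /xsection/= inE /D/= in_itv/= => /andP.
  rewrite lebesgue_measure_itv/= lte_fin /lo /hi.
  case: (ltgtP (X z.1) (X z.2)) => h.
  - by rewrite h ltr0_norm ?subr_lt0// opprB EFinB.
  - by rewrite h gtr0_norm ?subr_gt0// EFinB.
  - by rewrite h ltxx subrr normr0.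
(* Integrating over [c] first gave the length of [[lo z, hi z[]; the other order is equal by
   uniqueness of the product measure. *)
transitivity (((P \x P) \x^ mu) D)%E.
  pose PP : probability (T * T)%type R := (P \x P)%E.
  pose m2 : {measure set ((T * T) * measurableTypeR R) -> \bar R} := (PP \x^ mu)%E.
  apply: (@product_measure_unique _ _ _ _ R PP mu m2) => // A B mA mB.
  exact: product_measure2E.
apply: eq_integral => c _ /=.
have mA : measurable [set x | X x <= c].
  rewrite -[X in measurable X]setTI (_ : mkset _ = X @^-1` `]-oo, c]); first exact: mX.
  by apply/seteqP; split => x; rewrite /= in_itv.
have mB : measurable [set x | c < X x].
  rewrite -[X in measurable X]setTI (_ : mkset _ = X @^-1` `]c, +oo[); first exact: mX.
  by apply/seteqP; split => x; rewrite /= in_itv/= andbT.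
rewrite (_ : ysection D c = [set x | X x <= c] `*` [set x | c < X x] `|`
    [set x | c < X x] `*` [set x | X x <= c]); last first.
  apply/seteqP; split => -[x y]; rewrite /ysection/= inE /D/= /lo /hi/=.
    by move=> []; rewrite ge_min lt_max => /orP[] ? /orP[] ?; [lra|left|right|lra].
  by rewrite ge_min lt_max => -[[? ?]|[? ?]]; split; apply/orP; [left|right|right|left].
rewrite measureU; [|exact: measurableX|exact: measurableX|].
  by congr (_ + _)%E; exact: product_measure1E.
apply/seteqP; split => -[x y] //= [[? ?] [? ?]]; lra.
Qed.

End layer_cake.

(** * The expectation *)

Section bernstein_dispersion.
Context {R : realType}.
Implicit Types (c : R) (n : nat).

Lemma bernstein_tailE n l c :
  bernstein_tail n l c = \sum_(j < n.+1) (l <= j)%:R * bernstein n j c.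
Proof.
rewrite /bernstein_tail big_geq_mkord big_mkcond /=; apply: eq_bigr => j _.
by case: ifP; rewrite ?mul1r ?mul0r.
Qed.

(* Both sides are E|B - B'| for independent binomial variables B and B' of
   parameters n and c. *)
Lemma bernstein_dispersion n c :
  \sum_(k < n.+1) 2 * (bernstein_tail n (n - k) c * (1 - bernstein_tail n (n - k) c))
  = \sum_(i < n.+1) \sum_(j < n.+1)
      `|i%:R - j%:R| * (bernstein n i c * bernstein n j c).
Proof.
pose g l := 2 * (bernstein_tail n l c * (1 - bernstein_tail n l c)).
(* As [g] vanishes at both [0] and [n + 1], the sum over the levels [0..n] can be moved to [1..n+1],
   where level [k + 1] corresponds to the cut after [k]. *)
have g0 : g 0%N = 0.
  rewrite /g (_ : bernstein_tail n 0 c = 1) ?subrr ?mulr0//.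
  by rewrite /bernstein_tail big_mkord sum_bernstein.
have gn : g n.+1 = 0 by rewrite /g /bernstein_tail big_geq// mul0r mulr0.
transitivity (\sum_(k < n.+1) g k.+1).
  transitivity (\sum_(k < n.+1) g k).
    rewrite [RHS](reindex_inj rev_ord_inj)/=; apply: eq_bigr => k _.
    by rewrite subSS.
  transitivity (\sum_(k < n.+2) g k).
    by rewrite [RHS]big_ord_recr/= gn addr0.
  by rewrite big_ord_recl g0 add0r.
under [RHS]eq_bigr do under eq_bigr do rewrite distn_sum_ord mulr_suml.
under [RHS]eq_bigr do rewrite exchange_big.
rewrite [RHS]exchange_big; apply: eq_bigr => k _ /=.
(* The two equal products stand for the two ways in which the cut can separate [i] from [j]. *)
have -> : g k.+1 = (1 - bernstein_tail n k.+1 c) * bernstein_tail n k.+1 c +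
   bernstein_tail n k.+1 c * (1 - bernstein_tail n k.+1 c).
  by rewrite /g; ring.
have -> : 1 - bernstein_tail n k.+1 c =
    \sum_(j < n.+1) (j <= k)%:R * bernstein n j c.
  rewrite -{1}(sum_bernstein n c) bernstein_tailE -sumrB; apply: eq_bigr => j _.
  by rewrite ltnNge; case: (j <= k)%N => /=; ring.
rewrite bernstein_tailE !mulr_suml -big_split; apply: eq_bigr => i _ /=.
rewrite !mulr_sumr -big_split; apply: eq_bigr => j _ /=.
rewrite !ltnNge; case: (i <= k)%N; case: (j <= k)%N => /=;
  rewrite ?subrr ?subr0 ?sub0r ?normrN ?normr0 ?normr1; ring.
Qed.

Lemma bernstein_ge0 n j c : 0 <= c <= 1 -> 0 <= bernstein n j c.
Proof.
by move=> /andP[c0 c1]; rewrite !mulr_ge0// exprn_ge0// subr_ge0.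
Qed.

Lemma bernstein_tail_ge0 n l c : 0 <= c <= 1 -> 0 <= bernstein_tail n l c.
Proof. by move=> c01; rewrite sumr_ge0// => j _; exact: bernstein_ge0. Qed.

Lemma bernstein_tail_le1 n l c : 0 <= c <= 1 -> bernstein_tail n l c <= 1.
Proof.
move=> c01; rewrite bernstein_tailE -[leRHS](sum_bernstein n c); apply: ler_sum => j _.
by case: (l <= j)%N; rewrite ?mul1r ?mul0r ?bernstein_ge0.
Qed.

Lemma measurable_bernstein n j (D : set R) : measurable_fun D (bernstein n j).
Proof. by apply: measurable_funM => //; exact: measurable_XMonemX. Qed.

(** The integrand is a constant times [c^(i+j) (1-c)^(2n-i-j)], whose beta integral is
    [(i+j)! (2n-i-j)! / (2n+1)!]. *)
Lemma integral_bernstein n i j : (i <= n)%N -> (j <= n)%N ->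
  (\int[lebesgue_measure]_(c in `[0%R, 1%R]) (bernstein n i c * bernstein n j c)%:E
   = (shuffle_weight n n i j / (n + n).+1%:R :> R)%:E)%E.
Proof.
move=> i_n j_n.
rewrite (@eq_integral _ _ R lebesgue_measure _ (fun c =>
  ('C(n, i)%:R * 'C(n, j)%:R)%:E * (XMonemX (i + j) (n + n - (i + j)) c)%:E)%E).
  rewrite ge0_integralZl_EFin ?mulr_ge0//=; last 2 first.
  - by move=> c c01; rewrite lee_fin XMonemX_ge0.
  - by apply/measurable_EFinP; exact: measurable_XMonemX.
  have -> : (\int[lebesgue_measure]_(c in `[0%R, 1%R])
      (XMonemX (i + j) (n + n - (i + j)) c)%:E
      = (beta_fun (i + j).+1 (n + n - (i + j)).+1 : R)%:E)%E.
    rewrite EFin_beta_fun/= [LHS]integral_mkcond; apply: eq_integral => c _.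
    by rewrite restrict_EFin.
  rewrite beta_fun_fact -EFinM; congr EFin.
  rewrite /shuffle_weight (_ : (i + j + (n + n - (i + j)) = n + n)%N); last by lia.
  rewrite factS !natrM; field.
  by rewrite -natrD nat1r !pnatr_eq0 -!lt0n fact_gt0.
move=> c _; rewrite -EFinM; congr EFin; rewrite /bernstein /XMonemX /unstable.onem.
rewrite (_ : (n + n - (i + j) = (n - i) + (n - j))%N); last by lia.
by rewrite !exprD; ring.
Qed.

End bernstein_dispersion.

Section expected_EMD.
Context {R : realType}.
Notation mu := (@lebesgue_measure R).

Lemma measurable_cumul n k : measurable_fun setT (fun f : n.-tuple R => cumul f k).
Proof.
rewrite (_ : (fun f => _) = (fun f : n.-tuple R =>
  \sum_(i < n) if (i < k)%N then tnth f i else 0)); last first.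
  by apply/funext => f; rewrite /cumul big_mkcond.
apply: (@measurable_sum _ _ _ _ _ _
  (fun (i : 'I_n) (f : n.-tuple R) => if (i < k)%N then tnth f i else 0)) => i.
by case: (i < k)%N => //; exact: measurable_tnth.
Qed.

Lemma measurable_cumul_dist n k : measurable_fun setT
  (fun z : n.-tuple R * n.-tuple R => `|cumul z.1 k - cumul z.2 k|).
Proof.
apply: measurableT_comp => //; apply: measurable_funB.
  exact: (measurableT_comp (@measurable_cumul n k) measurable_fst).
exact: (measurableT_comp (@measurable_cumul n k) measurable_snd).
Qed.

(** This is [mean_abs_diff] for the tail sum [1 - cumul f k.+1]. Its distribution function is 0
    below 0 and 1 above 1, so only [[0, 1]] contributes. *)
Lemma mean_cumul_diff n k : (k <= n)%N ->
  (\int[uniform_simplex R n \x uniform_simplex R n]_z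
     `|cumul z.1 k.+1 - cumul z.2 k.+1|%:E =
   \int[mu]_(c in `[0%R, 1%R])
     (2 * (bernstein_tail n (n - k) c * (1 - bernstein_tail n (n - k) c)))%:E)%E.
Proof.
move=> kn; pose P := uniform_simplex R n; pose X (f : n.+1.-tuple R) := 1 - cumul f k.+1.
have mX : measurable_fun setT X.
  by apply: measurable_funB => //; exact: measurable_cumul.
transitivity (\int[P \x P]_z `|X z.1 - X z.2|%:E)%E.
  apply: eq_integral => z _; congr EFin.
  by rewrite distrC; congr `|_|; rewrite /X; ring.
rewrite mean_abs_diff// [RHS]integral_mkcond; apply: eq_integral => c _.
have -> : P [set f | c < X f] = (1 - P [set f | X f <= c]%R)%E.
  rewrite -probability_setC.
    by congr (P _); apply/seteqP; split => f /=; rewrite ltNge => /negP.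
  rewrite -[X in measurable X]setTI (_ : mkset _ = X @^-1` `]-oo, c]); first exact: mX.
  by apply/seteqP; split => x; rewrite /= in_itv.
rewrite patchE mem_setE in_itv/=.
have [c0|c0] /= := leP 0 c; last first.
  by rewrite uniform_simplex_cumul_lt0// mul0e mule0 adde0.
have [c1|c1] := leP c 1; last first.
  by rewrite uniform_simplex_cumul_ge1 1?ltW// subee// mul0e mule0 adde0.
rewrite uniform_simplex_cumul_bernstein ?c0//.
by rewrite -EFinB -!EFinM -EFinD; congr EFin; ring.
Qed.

Lemma mean_EMD_cumul n :
  (\int[uniform_simplex R n \x uniform_simplex R n]_z (EMD z.1 z.2)%:E =
   \int[uniform_simplex R n \x uniform_simplex R n]_z
     (\sum_(k < n.+1) `|cumul z.1 k.+1 - cumul z.2 k.+1|)%:E)%E.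
Proof.
pose T := n.+1.-tuple R; pose P := uniform_simplex R n.
(* Outside [D] there is no coupling, so [EMD] is [g] times the indicator of [D] everywhere, which
   makes it measurable. *)
pose D := [set z : T * T | [/\ forall i, 0 <= tnth z.1 i, forall i, 0 <= tnth z.2 i
      & \sum_i tnth z.1 i = \sum_i tnth z.2 i]].
pose g (z : T * T) := \sum_(k < n.+1) `|cumul z.1 k.+1 - cumul z.2 k.+1|.
have mg : measurable_fun setT g.
  apply: (@measurable_sum _ _ _ _ _ _ (fun (k : 'I_n.+1) (z : T * T) =>
    `|cumul z.1 k.+1 - cumul z.2 k.+1|)) => k.
  exact: measurable_cumul_dist.
have mtot (p : T * T -> T) : measurable_fun setT p ->
    measurable_fun setT (fun z => \sum_i tnth (p z) i).
  move=> mp; apply: (@measurable_sum _ _ _ _ _ _ (fun i z => tnth (p z) i)) => i.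
  exact: (measurableT_comp (measurable_tnth i) mp).
have mge0 (p : T * T -> T) : measurable_fun setT p ->
    measurable [set z | forall i, 0 <= tnth (p z) i].
  move=> mp; rewrite (_ : mkset _ = \bigcap_(i in [set: 'I_n.+1])
      ((fun z => tnth (p z) i) @^-1` `[0, +oo[)).
    apply: fin_bigcap_measurable => // i _.
    have m : measurable_fun setT (fun z => tnth (p z) i).
      exact: (measurableT_comp (measurable_tnth i) mp).
    by rewrite -[X in measurable X]setTI; exact: m.
  apply/seteqP; split => z /= z0 i.
    by move=> _; rewrite /= in_itv/= z0.
  by have /= := z0 i Logic.I; rewrite in_itv/= andbT.
have mD : measurable D.
  rewrite (_ : D = [set z | forall i, 0 <= tnth z.1 i] `&`
      [set z | forall i, 0 <= tnth z.2 i] `&`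
      ((fun z => \sum_i tnth z.1 i - \sum_i tnth z.2 i) @^-1` [set 0])).
    apply: measurableI; first by apply: measurableI; exact: mge0.
    have m : measurable_fun setT (fun z : T * T => \sum_i tnth z.1 i - \sum_i tnth z.2 i).
      by apply: measurable_funB; exact: mtot.
    by rewrite -[X in measurable X]setTI; exact: m.
  apply/seteqP; split => z /=.
    by move=> [z1 z2 z12]; split => //; rewrite z12 subrr.
  by move=> [[z1 z2] /eqP]; rewrite subr_eq0 => /eqP.
have EMDE (z : T * T) : EMD z.1 z.2 = g z * \1_D z.
  rewrite indicE; case: (pselect (D z)) => Dz.
    by rewrite mem_set// mulr1; case: Dz => z1 z2 z12; exact: EMD_cumul.
  by rewrite memNset// mulr0; exact: EMD_no_coupling.
apply: ae_eq_integral => //.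
- apply/measurable_EFinP; rewrite (_ : (fun z => _) = (fun z => g z * \1_D z)).
    by apply: measurable_funM => //; exact: measurable_indic.
  by apply/funext => z; exact: EMDE.
- exact/measurable_EFinP.
pose S := simplex R n.+1.
(* The product of the simplices has mass 1, and the cumulative formula holds on it. *)
exists (~` (S `*` S)); split.
- by apply: measurableC; apply: measurableX; exact: measurable_simplex.
- rewrite -/P; apply: etrans (probability_setC (P \x P)%E _) _.
    by apply: measurableX; exact: measurable_simplex.
  rewrite [X in (_ - X)%E](_ : _ = 1%E) ?subee//.
  have PS : P S = 1%E := uniform_simplex_simplex n.
  transitivity (P S * P S)%E; last by rewrite PS mule1.
  by apply: product_measure1E; exact: measurable_simplex.
move=> z /= nz [[z1 t1] [z2 t2]]; apply: nz => _; congr EFin.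
by apply: EMD_cumul => //; rewrite t1 t2.
Qed.

Lemma integral_EMD n :
  (\int[uniform_simplex R n \x uniform_simplex R n]_z (EMD z.1 z.2)%:E =
   (mean_EMD R n.+1 n.+1)%:E)%E.
Proof.
rewrite mean_EMD_cumul mean_EMD_shuffle.
under eq_integral do rewrite -sumEFin.
rewrite ge0_integral_sum//; last first.
  by move=> k; apply/measurable_EFinP; exact: measurable_cumul_dist.
under eq_bigr => k _ do rewrite mean_cumul_diff -1?ltnS//.
have c01 (c : R) : `[0, 1]%classic c -> 0 <= c <= 1 by rewrite /= in_itv.
(* The sum over [k] returns under the integral, where [bernstein_dispersion] turns it pointwise into
   a double sum over [i] and [j]; that one is then integrated term by term. *)
rewrite -ge0_integral_sum//; last 2 first.
- move=> k; apply/measurable_EFinP; apply: measurable_funM => //.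
  have mt : measurable_fun (`[0, 1]%classic : set R) (@bernstein_tail R n (n - k)).
    by apply: measurable_sum => j; exact: measurable_bernstein.
  by apply: measurable_funM => //; exact: measurable_funB.
- move=> k c /c01 c1; rewrite lee_fin mulr_ge0// mulr_ge0//.
    exact: bernstein_tail_ge0.
  by rewrite subr_ge0 bernstein_tail_le1.
have mb (i j : nat) : measurable_fun (`[0, 1]%classic : set R)
    (fun c : R => (bernstein n i c * bernstein n j c)%:E).
  by apply/measurable_EFinP; apply: measurable_funM; exact: measurable_bernstein.
have b0 (i j : nat) (c : R) : `[0, 1]%classic c ->
    (0 <= (bernstein n i c * bernstein n j c)%:E)%E.
  by move=> /c01 c1; rewrite lee_fin mulr_ge0// bernstein_ge0.
transitivity (\int[@lebesgue_measure R]_(c in `[0%R, 1%R]) \sum_(i < n.+1)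
    \sum_(j < n.+1) `|i%:R - j%:R|%:E * (bernstein n i c * bernstein n j c)%:E)%E.
  apply: eq_integral => c _; rewrite sumEFin bernstein_dispersion -sumEFin.
  by apply: eq_bigr => i _; rewrite -sumEFin.
have mt (i j : nat) : measurable_fun (`[0, 1]%classic : set R)
    (fun c : R => `|i%:R - j%:R|%:E * (bernstein n i c * bernstein n j c)%:E)%E.
  exact: measurable_funeM.
have t0 (i j : nat) (c : R) : `[0, 1]%classic c ->
    (0 <= `|i%:R - j%:R|%:E * (bernstein n i c * bernstein n j c)%:E)%E.
  by move=> c1; rewrite mule_ge0// b0.
rewrite ge0_integral_sum//; last 2 first.
- by move=> i; apply: emeasurable_sum => j; exact: mt.
- by move=> i c c1; apply: sume_ge0 => j _; exact: t0.
rewrite /shuffle_sum mulr_suml -sumEFin; apply: eq_bigr => i _.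
rewrite ge0_integral_sum//; last 2 first.
- by move=> j; exact: mt.
- by move=> j c c1; exact: t0.
rewrite mulr_suml -sumEFin; apply: eq_bigr => j _.
rewrite ge0_integralZl_EFin//; [|by move=> c c1; exact: b0|exact: mb].
by rewrite integral_bernstein -1?ltnS// -EFinM mulrA.
Qed.

End expected_EMD.

Local Open Scope ereal_scope.

Theorem theorem1 (R : realType) (n : nat) :
  'E_(uniform_simplex R n \x uniform_simplex R n)
    [fun x : n.+1.-tuple R * n.+1.-tuple R => EMD x.1 x.2]
  = (mean_EMD R n.+1 n.+1)%:E.
Proof. by rewrite unlock; exact: integral_EMD. Qed.
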